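(* Let FI be a randomized full information algorithm whose regret over any number $N$ of rounds is upper bounded by $C\sqrt N$ for some constant $C$ (see context), and let $C^I$ be the maximum loss, measured by $\mathrm{SumLoss}$, that the learner can suffer in a round. The expected regret under $\mathrm{SumLoss}$ obtained by applying the block algorithm RTop-kF described in the context, with $K$ blocks, subroutine FI, and relevance feedback on the top $k$ ranked items per round ($k\ge1$), the expectation being taken over the learner's randomized actions $\sigma_t$, satisfies $$\mathbb{E}\Big[\sum_{t=1}^T \mathrm{SumLoss}(\sigma_t,R_t)\Big]-\min_\sigma\sum_{t=1}^T\mathrm{SumLoss}(\sigma,R_t)\ \le\ C^I\lceil m/k\rceil K+C\frac{T}{\sqrt K}.$$ Optimizing over the blocking parameter $K$, the final regret bound is $$\mathbb{E}\Big[\sum_{t=1}^T \mathrm{SumLoss}(\sigma_t,R_t)\Big]-\min_\sigma\sum_{t=1}^T\mathrm{SumLoss}(\sigma,R_t)\ \le\ 2(C^I)^{1/3}C^{2/3}\lceil m/k\rceil^{1/3}T^{2/3}.$$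
   Context: There are $m$ fixed items. A permutation $\sigma$ of the items $1,\dots,m$ maps ranks to items, and $\sigma^{-1}$ maps items to ranks; $\mathrm{SumLoss}(\sigma,R)=\sigma^{-1}\cdot R=\sum_{i=1}^m\sigma^{-1}(i)R(i)$ for a relevance vector $R\in\{0,1\}^m$. Online game with an oblivious adversary over $T$ rounds: at round $t$ the learner outputs a permutation $\sigma_t$, the adversary generates $R_t\in\{0,1\}^m$, the learner suffers $\mathrm{SumLoss}(\sigma_t,R_t)$ and observes only $R_t(\sigma_t(1)),\dots,R_t(\sigma_t(k))$ (top $k$ feedback). Full information algorithm FI: given a vector $s\in\mathbb{R}^m$ (the sum of the information vectors seen so far) it maintains a distribution $\rho(s)$ over permutations and outputs a random permutation drawn from it. Its regret being bounded by $C\sqrt N$ over $N$ rounds means that for information vectors $y_1,\dots,y_N\in[0,1]^m$, each fully revealed at the end of its round, $\sum_{i=1}^N\mathbb{E}_{\sigma\sim\rho(y_1+\dots+y_{i-1})}[\sigma^{-1}\cdot y_i]-\min_\sigma\sum_{i=1}^N\sigma^{-1}\cdot y_i\le C\sqrt N$. Algorithm RTop-kF (non-contextual). Divide the time horizon $\{1,\dots,T\}$ into $K$ equal sized blocks $B_1,\dots,B_K$, $B_i=\{(i-1)(T/K)+1,\dots,i(T/K)\}$. Set $\hat s_0=\mathbf{0}\in\mathbb{R}^m$. For $i=1,\dots,K$: select $\lceil m/k\rceil$ time points $i_1,\dots,i_{\lceil m/k\rceil}$ from $B_i$ uniformly at random without replacement, and divide the $m$ items into $\lceil m/k\rceil$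 cells with $k$ distinct items in each cell (the last may have fewer). For $t\in B_i$: if $t=i_j$ (exploration round), output any permutation placing the items of the $j$th cell in the top positions and observe their relevances; otherwise (exploitation round) feed $\hat s_{i-1}$ to FI and output $\sigma_t$ drawn according to FI, i.e. from $\rho(\hat s_{i-1})$. At the end of block $i$ let $\hat R_i\in\mathbb{R}^m$ be the vector of the relevances of the $m$ items collected in the exploration rounds of the block, and set $\hat s_i=\hat s_{i-1}+\hat R_i$.
   Formalization: The final bound is proved when the number K of equal blocks (dividing T) minimizes the first bound over all integers K'≥1 with ⌈m/k⌉K'≤T; without such a condition it fails, e.g. for large prime T, m=2, k=1, where only K=1 is possible. *)

(* Defs.v *)
From mathcomp Require Import all_boot all_order all_algebra all_fingroup.
From mathcomp Require Import reals.

Set Implicit Arguments.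
Unset Strict Implicit.
Unset Printing Implicit Defensive.

Import Order.TTheory GRing.Theory Num.Theory.
Local Open Scope ring_scope.

(* Items, ranks, rounds, blocks and cells are all numbered from 0.
   [s : 'S_m] maps ranks to items, hence [s^-1] maps items to ranks. *)

Definition ceil_div (m k : nat) : nat := ((m + k.-1) %/ k)%N.

Section Game.
Variables (R : realType) (m : nat).

(* The [.+1] turns the 0-based rank into a rank in 1..m. *)
Definition SumLoss (s : 'S_m) (r : 'rV[R]_m) : R :=
  \sum_i ((s^-1)%g i).+1%:R * r 0 i.

Definition relevance (r : {ffun 'I_m -> bool}) : 'rV[R]_m := \row_i (r i)%:R.

Definition min_perm (F : 'S_m -> R) : R := \big[Num.min/F 1%g]_(s : 'S_m) F s.

(* The neutral value 0 is harmless: all losses are nonnegative. *)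
Definition max_loss : R :=
  \big[Num.max/0]_(s : 'S_m) \big[Num.max/0]_(r : {ffun 'I_m -> bool})
    SumLoss s (relevance r).

Definition is_distribution (p : 'S_m -> R) : Prop :=
  (forall s, 0 <= p s) /\ \sum_s p s = 1.

Definition full_info_algorithm (rho : 'rV[R]_m -> 'S_m -> R) : Prop :=
  forall v, is_distribution (rho v).

Definition full_info_regret_le (rho : 'rV[R]_m -> 'S_m -> R) (C : R) : Prop :=
  forall (N : nat) (y : nat -> 'rV[R]_m),
    (forall i x, 0 <= y i 0 x <= 1) ->
    \sum_(i < N) \sum_s rho (\sum_(j < i) y j) s * SumLoss s (y i)
      - min_perm (fun s => \sum_(i < N) SumLoss s (y i))
    <= C * Num.sqrt N%:R.

End Game.

(* What happens in one block of L rounds: the sampled time points, as offsets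
   in the block (the jth one is devoted to the jth cell), and the L outputs. *)
Notation block_run m k L :=
  ({ffun 'I_(ceil_div m k) -> 'I_L} * L.-tuple 'S_m)%type.

(* The choices the algorithm leaves open: the division into cells and the
   exploration permutations.  Both may depend on the runs [h] of the previous
   blocks; the latter also on the time points [tau] of the current block and on
   the outputs [past] already made in it. *)
Record exploration (m k L : nat) := Exploration {
  cell : seq (block_run m k L) -> 'I_m -> 'I_(ceil_div m k);
  explore : seq (block_run m k L) -> {ffun 'I_(ceil_div m k) -> 'I_L} ->
            seq 'S_m -> 'I_(ceil_div m k) -> 'S_m;
  card_cell : forall h (j : 'I_(ceil_div m k)), (j.+1 < ceil_div m k)%N ->
    #|[set x | cell h x == j]| = k;
  explore_top : forall h tau past j x, cell h x = j ->
    (((explore h tau past j)^-1)%g x < k)%N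
}.

Definition topk_feedback (m k : nat) (s : 'S_m) (r : {ffun 'I_m -> bool}) :
    seq bool :=
  take k [seq r (s q) | q <- enum 'I_m].

Section RTopkF.
Variables (R : realType) (m k L : nat).
Variables (rho : 'rV[R]_m -> 'S_m -> R) (E : exploration m k L).
Variable rel : nat -> {ffun 'I_m -> bool}.

(* [h] is the list of the runs of the blocks preceding the run [b], which is
   thus that of block [size h]; the relevance of x is read off the feedback of
   the round exploring the cell of x, at the rank given there to x. *)
Definition Rhat (h : seq (block_run m k L)) (b : block_run m k L) : 'rV[R]_m :=
  \row_x
    let l := b.1 (cell E h x) in
    let s := tnth b.2 l in
    (nth false (topk_feedback k s (rel (size h * L + l))) ((s^-1)%g x))%:R.

Definition shat (h : seq (block_run m k L)) : 'rV[R]_m :=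
  \sum_(i < size h) Rhat (take i h) (tnth (in_tuple h) i).

(* Conditional law of the output of round [l] of the block, given the past. *)
Definition output_law (h : seq (block_run m k L))
    (tau : {ffun 'I_(ceil_div m k) -> 'I_L}) (past : seq 'S_m) (l : 'I_L)
    (s : 'S_m) : R :=
  if [pick j | tau j == l] is Some j then (s == explore E h tau past j)%:R
  else rho (shat h) s.

(* Sampling without replacement: uniform law on injective families. *)
Definition sampling_law (tau : {ffun 'I_(ceil_div m k) -> 'I_L}) : R :=
  (injectiveb tau)%:R
    / #|[set f : {ffun 'I_(ceil_div m k) -> 'I_L} | injectiveb f]|%:R.

Definition block_law (h : seq (block_run m k L)) (b : block_run m k L) : R :=
  sampling_law b.1 * \prod_(l < L) output_law h b.1 (take l b.2) l (tnth b.2 l).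

Definition run_law (K : nat) (w : K.-tuple (block_run m k L)) : R :=
  \prod_(i < K) block_law (take i w) (tnth w i).

(* [1] is a junk default: there are [K * L] outputs. *)
Definition output (K : nat) (w : K.-tuple (block_run m k L)) (t : nat) : 'S_m :=
  nth 1%g (flatten [seq val b.2 | b <- w]) t.

Definition expected_loss (T K : nat) : R :=
  \sum_(w : K.-tuple (block_run m k L))
    run_law w * \sum_(t < T) SumLoss (output w t) (relevance R (rel t)).

Definition expected_regret (T K : nat) : R :=
  expected_loss T K
    - min_perm (fun s => \sum_(t < T) SumLoss s (relevance R (rel t))).

End RTopkF.

Definition blocking_bound (R : realType) (m k T : nat) (C : R) (K : nat) : R :=
  max_loss R m * (ceil_div m k)%:R * K%:R + C * (T%:R / Num.sqrt K%:R).

(* Main.v *)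
(* Charge every exploration round the maximal loss, and every round, explored or
   not, the loss of FI.  Given the previous blocks, [Rhat] averages to the mean
   relevance of the block, so up to the factor [T / K] FI plays in expectation
   against the estimates themselves.  Its guarantee holds for each realization
   of the K estimates, and the expectation of a minimum is at most the minimum
   of the expectations; this gives [C sqrt K * T / K].

   For the optimized bound, [C] cannot be small: the regret of any permutation
   in any round is at most [2 C], hence the total regret is at most [2 C T].
   This covers the case where the optimal block number would be less than 1. *)
Require Import Defs.
From mathcomp Require Import all_boot all_order all_algebra all_fingroup.
From mathcomp Require Import reals exp ring lra.

Set Implicit Arguments.
Unset Strict Implicit.
Unset Printing Implicit Defensive.

Import Order.TTheory GRing.Theory Num.Theory.
Local Open Scope ring_scope.

(** * Laws of random sequences given by conditional laws; they serve for the outputs in a block and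
    for the blocks in a run *)

Section SequentialLaw.
Variables (R : numFieldType) (A : finType) (q : seq A -> A -> R).

Definition seq_law n (w : n.-tuple A) : R :=
  \prod_(i < n) q (take i w) (tnth w i).

Definition seq_mean n (G : seq A -> R) : R :=
  \sum_(w : n.-tuple A) seq_law w * G w.

Lemma sum_tuple_rcons n (F : n.+1.-tuple A -> R) :
  \sum_w F w = \sum_(w : n.-tuple A) \sum_a F [tuple of rcons w a].
Proof.
rewrite pair_big /=.
pose f (p : n.-tuple A * A) := [tuple of rcons p.1 p.2].
pose g (w : n.+1.-tuple A) :=
  ([tuple of belast (thead w) (behead w)], last (thead w) (behead w)).
rewrite (reindex f) //; exists g => [[w a] _|w _]; last first.
  by apply: val_inj; rewrite /f /= -lastI [RHS](congr1 val (tuple_eta w)).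
rewrite /f /g; set z := [tuple of rcons _ _].
have Ez : val z = rcons w a by [].
have: rcons (belast (thead z) (behead z)) (last (thead z) (behead z))
      = rcons w a.
  by rewrite -lastI -Ez [RHS](congr1 val (tuple_eta z)).
by case/rcons_inj => H1 H2; congr (_, _) => //; apply: val_inj.
Qed.

Lemma seq_law_rcons n (w : n.-tuple A) a :
  seq_law [tuple of rcons w a] = seq_law w * q w a.
Proof.
rewrite /seq_law big_ord_recr /=; congr (_ * _).
  apply: eq_bigr => i _; rewrite !(tnth_nth a) /=.
  by rewrite -cats1 take_cat nth_cat size_tuple ltn_ord.
rewrite !(tnth_nth a) /= -cats1 nth_cat size_tuple ltnn subnn /=.
by congr q; rewrite take_cat size_tuple ltnn subnn take0 cats0.
Qed.

Lemma seq_mean0 G : seq_mean 0 G = G [::].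
Proof.
rewrite /seq_mean (bigD1 [tuple]) //= big1 ?addr0; last first.
  by move=> w /eqP[]; apply: tuple0.
by rewrite /seq_law big_ord0 mul1r.
Qed.

Lemma seq_meanS n G :
  seq_mean n.+1 G = seq_mean n (fun h => \sum_a q h a * G (rcons h a)).
Proof.
rewrite /seq_mean sum_tuple_rcons; apply: eq_bigr => w _.
by rewrite mulr_sumr; apply: eq_bigr => a _; rewrite seq_law_rcons mulrA.
Qed.

Lemma seq_meanD n G G' :
  seq_mean n (fun h => G h + G' h) = seq_mean n G + seq_mean n G'.
Proof. by rewrite -big_split; apply: eq_bigr => w _; rewrite mulrDr. Qed.

Lemma seq_meanZ n c G : seq_mean n (fun h => c * G h) = c * seq_mean n G.
Proof. by rewrite mulr_sumr; apply: eq_bigr => w _; rewrite mulrCA. Qed.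

Lemma eq_seq_mean n G G' : (forall w, size w = n -> G w = G' w) ->
  seq_mean n G = seq_mean n G'.
Proof. by move=> eqG; apply: eq_bigr => w _; rewrite eqG ?size_tuple. Qed.

Hypothesis q_ge0 : forall h a, 0 <= q h a.
Hypothesis q_sum1 : forall h, \sum_a q h a = 1.

Lemma seq_law_ge0 n (w : n.-tuple A) : 0 <= seq_law w.
Proof. exact: prodr_ge0. Qed.

Lemma le_seq_mean n G G' : (forall w, size w = n -> G w <= G' w) ->
  seq_mean n G <= seq_mean n G'.
Proof.
move=> leG; apply: ler_sum => w _.
by rewrite ler_wpM2l ?seq_law_ge0 ?leG ?size_tuple.
Qed.

Lemma seq_mean_cst n c : seq_mean n (fun=> c) = c.
Proof.
elim: n => [|n IHn]; first by rewrite seq_mean0.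
rewrite seq_meanS -[RHS]IHn; apply: eq_seq_mean => h _.
by rewrite -mulr_suml q_sum1 mul1r.
Qed.

(** Expectation of an additive functional: given the first [n] terms, only the increment [g] is
    averaged, under [q h]. Both inductions on the number of blocks rest on it. *)
Lemma seq_mean_rcons n (G : seq A -> R) (g : seq A -> A -> R) :
    (forall h a, size h = n -> G (rcons h a) = G h + g h a) ->
  seq_mean n.+1 G
    = seq_mean n G + seq_mean n (fun h => \sum_a q h a * g h a).
Proof.
move=> Gr; rewrite seq_meanS -seq_meanD; apply: eq_seq_mean => h sz_h.
under eq_bigr do rewrite Gr // mulrDr.
by rewrite big_split /= -mulr_suml q_sum1 mul1r.
Qed.

(* The remaining steps integrate to 1. *)
Lemma seq_mean_take n l (G : seq A -> R) : (l <= n)%N ->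
  seq_mean n (fun h => G (take l h)) = seq_mean l G.
Proof.
move=> le_ln; rewrite -(subnKC le_ln); elim: (n - l)%N => [|d IHd].
  by rewrite addn0; apply: eq_seq_mean => h <-; rewrite take_size.
rewrite addnS seq_meanS -IHd; apply: eq_seq_mean => h sz_h.
under eq_bigr do rewrite -cats1 takel_cat ?sz_h ?leq_addr //.
by rewrite -mulr_suml q_sum1 mul1r.
Qed.

(** Steps after [l] integrate to 1, so the sequence can be cut just after step [l], which is then
    its last one. *)
Lemma seq_mean_step n (l : 'I_n) (g : seq A -> A -> R) :
  \sum_(w : n.-tuple A) seq_law w * g (take l w) (tnth w l)
    = seq_mean l (fun h => \sum_a q h a * g h a).
Proof.
(* [A] is inhabited, since a sum over an empty type would be 0 and not 1; [a0] is a mere default for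
   [nth]. *)
have [a0 _|A0] := pickP A; last first.
  by have := q_sum1 [::]; rewrite big_pred0 // => /esym/eqP; rewrite oner_eq0.
pose G h := g (take l h) (nth a0 h l).
rewrite (eq_bigr (fun w : n.-tuple A => seq_law w * G (take l.+1 w))).
  rewrite -/(seq_mean n (fun h => G (take l.+1 h))) seq_mean_take //.
  rewrite seq_meanS; apply: eq_seq_mean => h sz_h; apply: eq_bigr => a _.
  by rewrite /G -cats1 take_cat nth_cat sz_h ltnn subnn take0 cats0.
move=> w _; rewrite /G (tnth_nth a0) take_takel ?leqnSn //.
by rewrite nth_take.
Qed.

End SequentialLaw.

(** * Linearity and bounds of the loss, minima over permutations *)

Section SumLossTheory.
Variables (R : realType) (m : nat).
Implicit Types (s : 'S_m) (u v : 'rV[R]_m) (F : 'S_m -> R).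

Lemma SumLossD s u v : SumLoss s (u + v) = SumLoss s u + SumLoss s v.
Proof. by rewrite -big_split; apply: eq_bigr => i _; rewrite mxE mulrDr. Qed.

Lemma SumLossZ s c u : SumLoss s (c *: u) = c * SumLoss s u.
Proof. by rewrite mulr_sumr; apply: eq_bigr => i _; rewrite mxE mulrCA. Qed.

Lemma SumLoss0 s : SumLoss s (0 : 'rV[R]_m) = 0.
Proof. by rewrite -(scale0r 0) SumLossZ mul0r. Qed.

Lemma SumLoss_sum s (I : finType) (u : I -> 'rV[R]_m) :
  SumLoss s (\sum_i u i) = \sum_i SumLoss s (u i).
Proof. by apply: big_morph; [exact: SumLossD | exact: SumLoss0]. Qed.

Lemma SumLoss_const s :
  SumLoss s (const_mx 1 : 'rV[R]_m) = \sum_(i < m) i.+1%:R.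
Proof.
rewrite /SumLoss (reindex_inj (@perm_inj _ s)); apply: eq_bigr => i _.
by rewrite permK mxE mulr1.
Qed.

Lemma SumLoss_relevance_ge0 s r : 0 <= SumLoss s (relevance R r).
Proof. by apply: sumr_ge0 => i _; rewrite mxE mulr_ge0 ?ler0n. Qed.

Lemma SumLoss_le_max s r : SumLoss s (relevance R r) <= max_loss R m.
Proof. by apply: le_trans (le_bigmax _ _ s); apply: (le_bigmax _ _ r). Qed.

Lemma max_loss_ge0 : 0 <= max_loss R m.
Proof.
exact: le_trans (SumLoss_relevance_ge0 1%g [ffun=> false]) (SumLoss_le_max _ _).
Qed.

Lemma relevance_itv r (x : 'I_m) : 0 <= relevance R r 0 x <= 1.
Proof. by rewrite mxE; case: (r x); rewrite ?lexx ?ler01. Qed.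

Lemma min_perm_le F s : min_perm F <= F s.
Proof. exact: bigmin_le. Qed.

Lemma le_min_perm F c : (forall s, c <= F s) -> c <= min_perm F.
Proof. by move=> leF; apply: le_bigmin. Qed.

End SumLossTheory.

Lemma sum_indicator_mul (R : pzSemiRingType) (I : finType) (x : I)
    (F : I -> R) :
  \sum_i (i == x)%:R * F i = F x.
Proof.
rewrite (bigD1 x) //= eqxx mul1r big1 ?addr0 // => i /negPf->.
exact: mul0r.
Qed.

Lemma sum_indicator (R : pzSemiRingType) (I : finType) (x : I) :
  \sum_i (i == x)%:R = 1 :> R.
Proof.
rewrite -[RHS](sum_indicator_mul x (fun=> 1)).
by apply: eq_bigr => i _; rewrite mulr1.
Qed.

(** * Sampling time points without replacement *)

Section Sampling.
Variables (R : realType) (m k L : nat).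
Local Notation c := (ceil_div m k).
Implicit Types tau : {ffun 'I_c -> 'I_L}.
Hypothesis le_cL : (c <= L)%N.

Lemma sampling_law_ge0 tau : 0 <= sampling_law R tau.
Proof. by rewrite mulr_ge0 ?invr_ge0 ?ler0n. Qed.

Lemma sampling_law_sum1 : \sum_tau @sampling_law R m k L tau = 1.
Proof.
rewrite -mulr_suml -natr_sum -big_mkcond sum1dep_card mulfV //.
by rewrite pnatr_eq0 card_inj_ffuns !card_ord -lt0n ffact_gt0.
Qed.

Lemma sampling_law_comp (s : 'S_L) tau :
  sampling_law R [ffun i => s (tau i)] = sampling_law R tau.
Proof.
congr (_%:R / _); congr nat_of_bool; apply/injectiveP/injectiveP => inj i j.
  by move=> tij; apply: inj; rewrite !ffunE tij.
by rewrite !ffunE => /perm_inj/inj.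
Qed.

(** Each sampled time point is uniform in the block: transposing two time points preserves the law,
    so the weights [W l] are all equal, and they sum to 1. *)
Lemma sampling_marginal j (F : 'I_L -> R) :
  L%:R * (\sum_tau @sampling_law R m k L tau * F (tau j)) = \sum_l F l.
Proof.
pose W l := \sum_tau @sampling_law R m k L tau * (tau j == l)%:R.
have W_cst l l' : W l = W l'.
  rewrite /W (reindex_inj (h := fun tau => [ffun i => tperm l l' (tau i)])) /=.
    apply: eq_bigr => tau _; rewrite sampling_law_comp ffunE; congr (_ * _%:R).
    by rewrite (can2_eq (tpermK l l') (tpermK l l')) tpermL.
  move=> f g /ffunP efg; apply/ffunP => i; have := efg i.
  by rewrite !ffunE => /perm_inj.
have W_sum : \sum_l W l = 1.
  rewrite exchange_big -[RHS]sampling_law_sum1 /=; apply: eq_bigr => tau _.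
  under eq_bigr do rewrite eq_sym.
  by rewrite -mulr_sumr sum_indicator mulr1.
have LW l : L%:R * W l = 1.
  rewrite -[RHS]W_sum (eq_bigr (fun=> W l)) => [|l' _]; last exact: W_cst.
  by rewrite sumr_const card_ord mulr_natl.
transitivity (L%:R * \sum_l W l * F l); last first.
  by rewrite mulr_sumr; apply: eq_bigr => l _; rewrite mulrA LW mul1r.
congr (_ * _); under [RHS]eq_bigr do rewrite mulr_suml.
rewrite exchange_big; apply: eq_bigr => tau _ /=.
rewrite -(sum_indicator_mul (tau j) F) mulr_sumr; apply: eq_bigr => l _.
by rewrite eq_sym mulrA.
Qed.

End Sampling.

(** * One block, given the previous ones: unbiased estimate and expected loss *)

Section Block.
Variables (R : realType) (m k L : nat).
Variables (rho : 'rV[R]_m -> 'S_m -> R) (E : exploration m k L).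
Variable rel : nat -> {ffun 'I_m -> bool}.
Local Notation c := (ceil_div m k).
Implicit Types (h : seq (block_run m k L)) (tau : {ffun 'I_c -> 'I_L}).
Implicit Types (past : seq 'S_m) (o : L.-tuple 'S_m).
Hypothesis le_cL : (c <= L)%N.
Hypothesis rho_distr : full_info_algorithm rho.

Local Notation rel_in h l := (relevance R (rel (size h * L + l))).

(* The law of an output given the list of the previous ones, completed by a
   junk value so that it is a probability after any list. *)
Definition output_kernel h tau past s : R :=
  if insub (size past) is Some l then output_law rho E rel h tau past l s
  else (s == 1%g)%:R.

Lemma output_kernel_ge0 h tau past s : 0 <= output_kernel h tau past s.
Proof.
rewrite /output_kernel /output_law; case: insub => [l|//].
by case: pickP => // _; have [] := rho_distr (shat R E rel h).
Qed.

Lemma output_kernel_sum1 h tau past : \sum_s output_kernel h tau past s = 1.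
Proof.
rewrite /output_kernel /output_law; case: insub => [l|].
  case: pickP => [j _|_]; first exact: sum_indicator.
  by have [] := rho_distr (shat R E rel h).
exact: sum_indicator.
Qed.

Lemma block_lawE h b :
  block_law rho E rel h b
    = sampling_law R b.1 * seq_law (output_kernel h b.1) b.2.
Proof.
congr (_ * _); apply: eq_bigr => l _; rewrite /output_kernel.
by rewrite size_take size_tuple ltn_ord valK.
Qed.

Lemma block_mean h (f : block_run m k L -> R) :
  \sum_b block_law rho E rel h b * f b
    = \sum_tau @sampling_law R m k L tau
        * \sum_(o : L.-tuple 'S_m) seq_law (output_kernel h tau) o * f (tau, o).
Proof.
under [RHS]eq_bigr do rewrite mulr_sumr.
rewrite pair_big /=; apply: eq_bigr => -[tau o] _.
by rewrite block_lawE mulrA.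
Qed.

Lemma seq_law_sum1 h tau :
  \sum_(o : L.-tuple 'S_m) seq_law (output_kernel h tau) o = 1.
Proof.
rewrite -[RHS](seq_mean_cst (output_kernel_sum1 h tau) L).
by apply: eq_bigr => o _; rewrite mulr1.
Qed.

Lemma block_law_ge0 h b : 0 <= block_law rho E rel h b.
Proof.
rewrite block_lawE mulr_ge0 ?sampling_law_ge0 ?seq_law_ge0 //.
exact: output_kernel_ge0.
Qed.

Lemma block_law_sum1 h : \sum_b block_law rho E rel h b = 1.
Proof.
transitivity (\sum_b block_law rho E rel h b * 1).
  by apply: eq_bigr => b _; rewrite mulr1.
rewrite block_mean -[RHS](sampling_law_sum1 R le_cL).
apply: eq_bigr => tau _; rewrite -[RHS]mulr1; congr (_ * _).
by rewrite -[RHS](seq_law_sum1 h tau); apply: eq_bigr => o _; rewrite mulr1.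
Qed.

(** In a run of positive probability, the round [tau j] really outputs the exploration permutation,
    which ranks the cell of [x] within the observed top [k]. *)
Lemma RhatE h tau o : injective tau -> seq_law (output_kernel h tau) o != 0 ->
  Rhat R E rel h (tau, o)
    = \row_x relevance R (rel (size h * L + tau (cell E h x))) 0 x.
Proof.
move=> tau_inj /prodf_neq0 o_pos; apply/rowP => x; rewrite !mxE /=.
set j := cell E h x; have := o_pos (tau j) isT; rewrite /output_kernel.
rewrite size_take size_tuple ltn_ord valK /output_law.
(* Injectivity of [tau] makes the picked index the cell of [x] itself. *)
case: pickP => [j' /eqP/tau_inj->|/(_ j)]; last by rewrite eqxx.
rewrite pnatr_eq0 eqb0 negbK => /eqP o_j.
have lt_k := explore_top tau (take (tau j) o) (erefl j).
rewrite o_j /topk_feedback nth_take //.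
set s := explore _ _ _ _ _.
by rewrite (nth_map ((s^-1)%g x)) ?size_enum_ord // nth_ord_enum permKV.
Qed.

(** Unbiasedness of the estimate. By linearity of the loss only the marginal of each single time
    point matters, not the joint law of the sample. *)
Lemma block_Rhat_mean h s :
  L%:R * \sum_b block_law rho E rel h b * SumLoss s (Rhat R E rel h b)
    = \sum_(l < L) SumLoss s (rel_in h l).
Proof.
rewrite block_mean.
pose r tau : 'rV[R]_m := \row_x rel_in h (tau (cell E h x)) 0 x.
have -> : \sum_tau @sampling_law R m k L tau * (\sum_(o : L.-tuple 'S_m)
      seq_law (output_kernel h tau) o * SumLoss s (Rhat R E rel h (tau, o)))
    = \sum_tau @sampling_law R m k L tau * SumLoss s (r tau).
  apply: eq_bigr => tau _.
  (* Families with repeated time points have probability 0. *)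
  have [tau_inj|ninj] := boolP (injectiveb tau); last first.
    by rewrite /sampling_law (negPf ninj) !mul0r.
  congr (_ * _); rewrite -[RHS]mul1r -(seq_law_sum1 h tau) mulr_suml.
  apply: eq_bigr => o _.
  have [->|o_pos] := eqVneq (seq_law (output_kernel h tau) o) 0.
    by rewrite !mul0r.
  by rewrite (RhatE (injectiveP _ tau_inj) o_pos).
under eq_bigr do rewrite mulr_sumr.
rewrite exchange_big mulr_sumr [RHS]exchange_big; apply: eq_bigr => x _ /=.
rewrite -(sampling_marginal le_cL (cell E h x) (fun l =>
  ((s^-1)%g x).+1%:R * rel_in h l 0 x)).
by congr (_ * _); apply: eq_bigr => tau _; rewrite !mxE.
Qed.

Lemma block_loss_le h :
  \sum_b block_law rho E rel h b
      * (\sum_(l < L) SumLoss (tnth b.2 l) (rel_in h l))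
    <= max_loss R m * c%:R
       + \sum_s rho (shat R E rel h) s * \sum_(l < L) SumLoss s (rel_in h l).
Proof.
rewrite block_mean; set B := (X in _ <= X).
rewrite -[B]mul1r -(sampling_law_sum1 R le_cL) mulr_suml.
apply: ler_sum => tau _; rewrite ler_wpM2l ?sampling_law_ge0 //= {}/B.
have [rho_ge0 rho_sum1] := rho_distr (shat R E rel h).
(* Counting explorations as indicators allows a comparison round by round. *)
have -> : c%:R = \sum_(l < L) \sum_(j < c) (l == tau j)%:R :> R.
  rewrite exchange_big (eq_bigr (fun=> 1)) => [|j _]; last exact: sum_indicator.
  by rewrite sumr_const card_ord.
under eq_bigr do rewrite mulr_sumr.
under [X in _ <= _ + X]eq_bigr do rewrite mulr_sumr.
rewrite exchange_big [X in _ <= _ + X]exchange_big /=.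
rewrite mulr_sumr -big_split; apply: ler_sum => l _ /=.
rewrite (seq_mean_step (output_kernel_sum1 h tau) l
  (fun past s => SumLoss s (rel_in h l))).
set B := (X in _ <= X).
rewrite -[B](seq_mean_cst (output_kernel_sum1 h tau) l).
apply: le_seq_mean => [past s|past sz_past]; first exact: output_kernel_ge0.
have exploit_ge0 : 0 <= \sum_s rho (shat R E rel h) s * SumLoss s (rel_in h l).
  by apply: sumr_ge0 => s _; rewrite mulr_ge0 ?rho_ge0 ?SumLoss_relevance_ge0.
rewrite {}/B /output_kernel sz_past valK /output_law.
(* In an exploration round the FI loss is nonnegative slack; in an exploitation round the output law
   is FI itself. *)
case: pickP => [j /eqP tau_j|tau'l]; last first.
  by rewrite lerDr mulr_ge0 ?max_loss_ge0 ?sumr_ge0.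
apply: ler_wpDr => //; apply: (@le_trans _ _ (max_loss R m)).
  rewrite -[leRHS](sum_indicator_mul (explore E h tau past j)
    (fun=> max_loss R m)).
  by apply: ler_sum => s _; rewrite ler_wpM2l ?ler0n ?SumLoss_le_max.
rewrite ler_peMr ?max_loss_ge0 // (bigD1 j) //= tau_j eqxx lerDl.
exact: sumr_ge0.
Qed.

End Block.

(** * The whole run: from blocks to the regret over [T] rounds *)

Section Run.
Variables (R : realType) (m k L : nat).
Variables (rho : 'rV[R]_m -> 'S_m -> R) (E : exploration m k L).
Variable rel : nat -> {ffun 'I_m -> bool}.
Local Notation c := (ceil_div m k).
Implicit Types (h : seq (block_run m k L)) (b : block_run m k L).
Hypothesis le_cL : (c <= L)%N.
Hypothesis rho_distr : full_info_algorithm rho.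

Local Notation rel_in h l := (relevance R (rel (size h * L + l))).
Local Notation Rhat := (Rhat R E rel).
Local Notation shat := (shat R E rel).
Local Notation run_mean := (seq_mean (block_law rho E rel)).
Let law_ge0 := block_law_ge0 E rel rho_distr.
Let law_sum1 := block_law_sum1 E rel le_cL rho_distr.

Definition total_loss h : R :=
  \sum_(t < size h * L)
     SumLoss (nth 1%g (flatten [seq val b.2 | b <- h]) t) (relevance R (rel t)).

(** The loss of FI playing one round per block against the estimates. An estimate is written as an
    increment of [shat], which makes sense at every index. *)
Definition full_info_loss h : R :=
  \sum_(i < size h) \sum_s rho (shat (take i h)) s
    * SumLoss s (shat (take i.+1 h) - shat (take i h)).

Lemma shat_nil : shat [::] = 0.
Proof. exact: big_ord0. Qed.

Lemma shat_rcons h b : shat (rcons h b) = shat h + Rhat h b.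
Proof.
have shatE h' : shat h' = \sum_(i < size h') Rhat (take i h') (nth b h' i).
  by apply: eq_bigr => i _; rewrite (tnth_nth b).
rewrite !shatE size_rcons big_ord_recr /=; congr (_ + _).
  apply: eq_bigr => i _.
  by rewrite -cats1 takel_cat ?nth_cat ?ltn_ord // ltnW.
by rewrite nth_rcons ltnn eqxx -cats1 take_size_cat.
Qed.

Lemma size_flatten_runs h :
  size (flatten [seq val b.2 | b <- h]) = (size h * L)%N.
Proof.
by elim: h => //= b h IHh; rewrite size_cat size_tuple IHh mulSn.
Qed.

Lemma total_loss_rcons h b :
  total_loss (rcons h b)
    = total_loss h + \sum_(l < L) SumLoss (tnth b.2 l) (rel_in h l).
Proof.
rewrite /total_loss size_rcons mulSnr big_split_ord /=; congr (_ + _).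
  apply: eq_bigr => t _; rewrite -cats1 map_cat flatten_cat nth_cat.
  by rewrite size_flatten_runs ltn_ord.
apply: eq_bigr => l _; rewrite -cats1 map_cat flatten_cat nth_cat.
rewrite size_flatten_runs ltnNge leq_addr /= addKn cats0.
by rewrite (tnth_nth 1%g).
Qed.

Lemma expected_lossE T K : T = (K * L)%N ->
  expected_loss rho E rel T K = run_mean K total_loss.
Proof.
move->; apply: eq_bigr => w _.
by rewrite /total_loss size_tuple.
Qed.

Lemma full_info_loss_rcons h b :
  full_info_loss (rcons h b)
    = full_info_loss h + \sum_s rho (shat h) s * SumLoss s (Rhat h b).
Proof.
rewrite /full_info_loss size_rcons big_ord_recr /=; congr (_ + _).
  apply: eq_bigr => i _.
  by rewrite -cats1 !takel_cat ?ltn_ord // ltnW.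
have -> : take (size h) (rcons h b) = h by rewrite -cats1 take_size_cat.
have -> : take (size h).+1 (rcons h b) = rcons h b.
  by rewrite -(size_rcons h b) take_size.
by rewrite shat_rcons [shat h + _]addrC addrK.
Qed.

Lemma full_info_loss_le C h : full_info_regret_le rho C ->
  full_info_loss h
    <= C * Num.sqrt (size h)%:R + min_perm (fun s => SumLoss s (shat h)).
Proof.
pose y i := shat (take i.+1 h) - shat (take i h).
have y_sum n : \sum_(j < n) y j = shat (take n h).
  elim: n => [|n IHn]; first by rewrite big_ord0 take0 shat_nil.
  by rewrite big_ord_recr /= IHn addrC subrK.
have y01 i x : 0 <= y i 0 x <= 1.
  (* The guarantee of FI asks for vectors in the unit cube at all indices; beyond the end of [h] the
     increments vanish. *)
  rewrite /y; have [le_hi|lt_ih] := leqP (size h) i.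
    by rewrite !take_oversize ?(leqW le_hi) // subrr mxE lexx ler01.
  have [b0 _] : exists b0 : block_run m k L, True.
    by case: (h) lt_ih => [|b0 h'] // _; exists b0.
  rewrite (take_nth b0 lt_ih) shat_rcons addrC addKr mxE.
  by rewrite ler0n lern1 leq_b1.
move=> /(_ (size h) y y01); rewrite lerBlDr => reg_le.
have -> : full_info_loss h = \sum_(i < size h) \sum_s
    rho (\sum_(j < i) y j) s * SumLoss s (y i).
  by apply: eq_bigr => i _; rewrite y_sum.
apply: le_trans reg_le _; rewrite lerD2l; apply: le_min_perm => s.
apply: le_trans (min_perm_le _ s) _.
by rewrite -SumLoss_sum y_sum take_size.
Qed.

(** The distribution [rho (shat h)] is fixed by the previous blocks, so by unbiasedness the FI loss
    over the rounds of a block averages to [L] times its loss against the estimate. *)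
Lemma run_mean_total_loss_le K :
  run_mean K total_loss
    <= max_loss R m * c%:R * K%:R + L%:R * run_mean K full_info_loss.
Proof.
elim: K => [|K IHK].
  rewrite !seq_mean0 /total_loss /full_info_loss !big_ord0.
  by rewrite !mulr0 addr0.
rewrite (seq_mean_rcons law_sum1 (fun h b _ => total_loss_rcons h b)).
rewrite (seq_mean_rcons law_sum1 (fun h b _ => full_info_loss_rcons h b)).
rewrite mulrDr -natr1 mulrDr mulr1 addrACA lerD // -seq_meanZ.
rewrite -[max_loss R m * _](seq_mean_cst law_sum1 K) -seq_meanD.
apply: le_seq_mean => // h _.
apply: le_trans (block_loss_le E rel le_cL rho_distr h) _; rewrite lerD2l.
rewrite (eq_bigr _ (fun b _ => mulr_sumr _ _ _ _)) exchange_big mulr_sumr /=.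
apply: ler_sum => s _; rewrite -(block_Rhat_mean E rel le_cL rho_distr).
rewrite !mulr_sumr le_eqVlt; apply/orP/or_introl/eqP.
by apply: eq_bigr => b _; ring.
Qed.

Lemma run_mean_shat K s :
  L%:R * run_mean K (fun h => SumLoss s (shat h))
    = \sum_(t < K * L) SumLoss s (relevance R (rel t)).
Proof.
elim: K => [|K IHK].
  by rewrite seq_mean0 shat_nil SumLoss0 mulr0 big_ord0.
rewrite (seq_mean_rcons (g := fun h b => SumLoss s (Rhat h b)) law_sum1);
  last by move=> h b _; rewrite shat_rcons SumLossD.
rewrite mulrDr IHK mulSnr big_split_ord -seq_meanZ /=; congr (_ + _).
rewrite -[RHS](seq_mean_cst law_sum1 K); apply: eq_seq_mean => h sz_h.
by rewrite (block_Rhat_mean E rel le_cL rho_distr) sz_h.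
Qed.

Lemma expected_regret_blocks_le C T K :
    (0 < K)%N -> T = (K * L)%N -> full_info_regret_le rho C ->
  expected_regret rho E rel T K
    <= max_loss R m * c%:R * K%:R + C * (T%:R / Num.sqrt K%:R).
Proof.
move=> K_gt0 defT rho_reg; rewrite /expected_regret (expected_lossE defT).
(* A fixed comparator [s] is kept until the expectation is taken; the minimum over [s] comes
   last. *)
have FI_le s : L%:R * run_mean K full_info_loss
    <= C * (T%:R / Num.sqrt K%:R)
       + \sum_(t < T) SumLoss s (relevance R (rel t)).
  have -> : C * (T%:R / Num.sqrt K%:R) = L%:R * (C * Num.sqrt K%:R).
    have sqrtK : Num.sqrt K%:R != 0 :> R by rewrite gt_eqF ?sqrtr_gt0 ?ltr0n.
    rewrite defT natrM -{1}[K%:R](@sqr_sqrtr R) ?ler0n //.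
    by field.
  rewrite [in X in _ <= _ + X]defT -run_mean_shat -mulrDr ler_wpM2l ?ler0n //.
  rewrite -[X in _ <= X + _](seq_mean_cst law_sum1 K) -seq_meanD.
  apply: le_seq_mean => // h sz_h.
  apply: le_trans (full_info_loss_le h rho_reg) _.
  by rewrite sz_h lerD2l min_perm_le.
have {}FI_le : L%:R * run_mean K full_info_loss - C * (T%:R / Num.sqrt K%:R)
    <= min_perm (fun s => \sum_(t < T) SumLoss s (relevance R (rel t))).
  by apply: le_min_perm => s; rewrite lerBlDl.
have := run_mean_total_loss_le K; lra.
Qed.

(** Crude bound without learning, meant for [D] equal to the maximal loss or to [2 * C]. *)
Lemma expected_regret_rounds_le D T K : T = (K * L)%N ->
    (forall (s s' : 'S_m) r,
       SumLoss s (relevance R r) - SumLoss s' (relevance R r) <= D) ->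
  expected_regret rho E rel T K <= D * T%:R.
Proof.
move=> defT le_D; rewrite /expected_regret (expected_lossE defT) lerBlDl.
rewrite -lerBlDr; apply: le_min_perm => s'; rewrite lerBlDr.
rewrite -[X in _ <= X](seq_mean_cst law_sum1 K).
apply: le_seq_mean => // h sz_h; rewrite /total_loss sz_h -defT.
have -> : D * T%:R = \sum_(t < T) D by rewrite sumr_const card_ord mulr_natr.
by rewrite -big_split; apply: ler_sum => t _; rewrite -lerBlDl.
Qed.

End Run.

(** * Lower bound on [C], choice of the number of blocks, conclusion *)

(* One round against [y] and one against its complement: the two losses of any
   permutation add up to the same constant. *)
Lemma SumLoss_diff_le (R : realType) (m : nat) (rho : 'rV[R]_m -> 'S_m -> R)
    (C : R) (s s' : 'S_m) (y : 'rV[R]_m) :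
    full_info_algorithm rho -> full_info_regret_le rho C ->
    (forall x, 0 <= y 0 x <= 1) ->
  SumLoss s y - SumLoss s' y <= 2 * C.
Proof.
move=> rho_distr rho_reg y01.
(* With [N = 1] FI has seen nothing and plays [rho 0], the same law against [y] and against its
   complement. *)
have one_round (u : 'rV[R]_m) v : (forall x, 0 <= u 0 x <= 1) ->
    \sum_z rho 0 z * SumLoss z u <= C + SumLoss v u.
  move=> u01; have := rho_reg 1%N (fun=> u) (fun=> u01).
  rewrite big_ord1 big_ord0 sqrtr1 mulr1 lerBlDr => /le_trans; apply.
  by rewrite lerD2l; apply: le_trans (min_perm_le _ v) _; rewrite big_ord1.
pose y' : 'rV[R]_m := const_mx 1 - y.
have y'01 x : 0 <= y' 0 x <= 1.
  by rewrite !mxE; have /andP[] := y01 x; lra.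
have yy' z : SumLoss z y + SumLoss z y' = \sum_(i < m) i.+1%:R.
  by rewrite -SumLossD -(SumLoss_const R z) addrC subrK.
have tot : \sum_z rho 0 z * SumLoss z y + \sum_z rho 0 z * SumLoss z y'
    = \sum_(i < m) i.+1%:R.
  rewrite -big_split (eq_bigr (fun z => rho 0 z * \sum_(i < m) i.+1%:R)).
    by rewrite -mulr_suml (proj2 (rho_distr 0)) mul1r.
  by move=> z _; rewrite -(yy' z) mulrDr.
(* Comparing with [s'] on [y] and with [s] on [y'] and adding, the constant total cancels. *)
have := one_round y s' y01; have := one_round y' s y'01; have := yy' s; lra.
Qed.

(* At [K = w ^+ 2], where [w ^+ 3 = C T / (M c)], both terms of the blocking
   bound equal [M c w ^+ 2], half of the claimed bound.  Rounding [w ^+ 2] down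
   does not hurt, because the bound is at most [2 M c w ^+ 2] on
   [w ^+ 2 / 2 <= K <= w ^+ 2].  If [w <= 1] or [c w ^+ 2 > T], one of the
   first two hypotheses is stronger than the claim. *)
Lemma optimal_blocking (R : realType) (M C r : R) (c T : nat) :
    0 <= M -> 0 <= C -> (0 < c)%N ->
    r <= M * T%:R -> r <= 2 * C * T%:R ->
    (forall K, (0 < K)%N -> (c * K <= T)%N ->
       r <= M * c%:R * K%:R + C * (T%:R / Num.sqrt K%:R)) ->
  r <= 2 * M `^ (1 / 3) * C `^ (2 / 3) * c%:R `^ (1 / 3) * T%:R `^ (2 / 3).
Proof.
move=> M_ge0 C_ge0 c_gt0 r_leM r_leC r_leK.
(* In terms of the cube roots of [M], [C], [c] and [T], all identities below become polynomial or
   rational. *)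
have cube (z : R) : 0 <= z -> (z `^ (1 / 3)) ^+ 3 = z.
  move=> z0; rewrite -powR_mulrn ?powR_ge0 // -powRrM mul1r.
  by rewrite mulVf ?powRr1 ?pnatr_eq0.
have square (z : R) : z `^ (2 / 3) = (z `^ (1 / 3)) ^+ 2.
  by rewrite -powR_mulrn ?powR_ge0 // -powRrM mul1r mulrC.
rewrite !square; move: (cube _ M_ge0) (cube _ C_ge0) (cube _ (ler0n R c)).
move: (cube _ (ler0n R T)) (powR_ge0 M (1 / 3)) (powR_ge0 C (1 / 3)).
move: (powR_ge0 c%:R (1 / 3) : 0 <= _ :> R).
move: (powR_ge0 T%:R (1 / 3) : 0 <= _ :> R).
set p := M `^ _; set q := C `^ _; set d := c%:R `^ _; set t := T%:R `^ _.
move=> t_ge0 d_ge0 T_E p_ge0 q_ge0 M_E C_E c_E.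
have d_gt0 : 0 < d.
  rewrite lt0r d_ge0 andbT; apply/eqP => d0; move: c_E; rewrite d0 expr0n /=.
  by move/esym/eqP; rewrite pnatr_eq0 -leqn0 leqNgt c_gt0.
have pd_ge0 : 0 <= p * d by rewrite mulr_ge0.
have qt_ge0 : 0 <= q * t by rewrite mulr_ge0.
(* This is the case [w <= 1], stated without division since [p] may be 0. *)
have [qt_le|pd_lt] := lerP (q * t) (p * d).
  apply: le_trans r_leC _; rewrite -C_E -T_E.
  have -> : 2 * q ^+ 3 * t ^+ 3 = 2 * (q * t) ^+ 2 * (q * t) by ring.
  have -> : 2 * p * q ^+ 2 * d * t ^+ 2 = 2 * (q * t) ^+ 2 * (p * d) by ring.
  by rewrite ler_wpM2l // mulr_ge0 ?sqr_ge0.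
have [p0|p_neq0] := eqVneq p 0.
  apply: le_trans r_leM _; rewrite -M_E p0 expr0n /= mul0r.
  by rewrite mulr0 !mul0r.
have p_gt0 : 0 < p by rewrite lt0r p_neq0.
have pd_gt0 : 0 < p * d by rewrite mulr_gt0.
pose w := q * t / (p * d).
have wE : q * t = w * (p * d) by rewrite mulfVK // gt_eqF.
have w_gt1 : 1 < w by rewrite ltr_pdivlMr ?mul1r.
have boundE : 2 * p * q ^+ 2 * d * t ^+ 2 = (p * d) ^+ 3 * (2 * w ^+ 2).
  have -> : 2 * p * q ^+ 2 * d * t ^+ 2 = 2 * (p * d) * (q * t) ^+ 2 by ring.
  by rewrite wE; ring.
have [T_lt|le_T] := ltrP T%:R (c%:R * w ^+ 2).
  apply: le_trans r_leM _; rewrite boundE -M_E.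
  have -> : (p * d) ^+ 3 * (2 * w ^+ 2) = p ^+ 3 * (2 * (c%:R * w ^+ 2)).
    by rewrite -c_E; ring.
  rewrite ler_wpM2l ?exprn_ge0 //; have := ler0n R T; lra.
have w2_ge0 : 0 <= w ^+ 2 by apply: sqr_ge0.
pose K := Num.truncn (w ^+ 2).
have /andP[K_le w2_lt] : K%:R <= w ^+ 2 < K.+1%:R.
  exact: truncn_itv.
have K_gt0 : (0 < K)%N.
  rewrite lt0n; apply/eqP => K0; move: w2_lt; rewrite K0.
  by rewrite ltNge exprn_ege1 // ltW.
have cK_le : (c * K <= T)%N.
  by rewrite -(ler_nat R) natrM; apply: le_trans le_T; rewrite ler_wpM2l.
apply: le_trans (r_leK K K_gt0 cK_le) _; rewrite boundE.
have K_ge1 : 1 <= K%:R :> R by rewrite ler1n.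
set v := Num.sqrt K%:R.
have v_gt0 : 0 < v by rewrite sqrtr_gt0; lra.
have vE : K%:R = v ^+ 2 by rewrite sqr_sqrtr ?ler0n.
have v_le : v <= w.
  by rewrite -(@ler_pXn2r _ 2) ?nnegrE -?vE //; lra.
have -> : M * c%:R * K%:R + C * (T%:R / v)
    = (p * d) ^+ 3 * (v ^+ 2 + w ^+ 3 / v).
  rewrite mulrA -C_E -T_E -exprMn wE -M_E -c_E vE; ring.
rewrite ler_wpM2l ?exprn_ge0 // -lerBrDl ler_pdivrMr // -subr_ge0.
(* The goal [v ^+ 2 + w ^+ 3 / v <= 2 * w ^+ 2], multiplied by [v], vanishes at [v = w], hence the
   factor [w - v]. *)
have -> : (2 * w ^+ 2 - v ^+ 2) * v - w ^+ 3
    = (w - v) * (v ^+ 2 + w * v - w ^+ 2) by ring.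
rewrite mulr_ge0 ?subr_ge0 //.
(* The second factor is at least [2 * K - w ^+ 2], which is positive because [w ^+ 2 < K + 1] and
   [1 <= K]. *)
have : v ^+ 2 <= w * v by rewrite expr2 ler_wpM2r // ltW.
move: w2_lt; rewrite -natr1 -vE; lra.
Qed.

Theorem theorem8 (R : realType) (m k T K : nat) (C : R)
    (rho : 'rV[R]_m -> 'S_m -> R)
    (rel : nat -> {ffun 'I_m -> bool})
    (E : exploration m k (T %/ K)) :
  (0 < m)%N -> (0 < k)%N -> (0 < K)%N ->
  (K %| T)%N -> (ceil_div m k <= T %/ K)%N ->
  full_info_algorithm rho -> full_info_regret_le rho C ->
  expected_regret rho E rel T K
    <= max_loss R m * (ceil_div m k)%:R * K%:R + C * (T%:R / Num.sqrt K%:R)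
  /\
  ((forall K' : nat, (0 < K')%N -> (ceil_div m k * K' <= T)%N ->
      blocking_bound m k T C K <= blocking_bound m k T C K') ->
   expected_regret rho E rel T K
    <= 2 * max_loss R m `^ (1 / 3) * C `^ (2 / 3)
         * (ceil_div m k)%:R `^ (1 / 3) * T%:R `^ (2 / 3)).
Proof.
move=> m_gt0 k_gt0 K_gt0 K_dvd le_cL rho_distr rho_reg.
have defT : T = (K * (T %/ K))%N by rewrite mulnC divnK.
have reg_le :=
  expected_regret_blocks_le E rel le_cL rho_distr K_gt0 defT rho_reg.
split=> // K_opt.
(* Comparing a permutation with itself gives [0 <= 2 * C]. *)
have C_ge0 : 0 <= C.
  have := SumLoss_diff_le 1%g 1%g rho_distr rho_reg
    (relevance_itv R [ffun=> false]).
  by rewrite subrr; lra.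
have c_gt0 : (0 < ceil_div m k)%N.
  by rewrite divn_gt0 // -[X in (X <= _)%N](prednK k_gt0) -add1n leq_add2r.
apply: optimal_blocking (max_loss_ge0 _ _) C_ge0 c_gt0 _ _ _.
- apply: expected_regret_rounds_le => // s s' r; rewrite lerBlDr ler_wpDr //.
    exact: SumLoss_relevance_ge0.
  exact: SumLoss_le_max.
- apply: expected_regret_rounds_le => // s s' r.
  exact/SumLoss_diff_le/relevance_itv.
(* The regret with [K] blocks is bounded by the value at [K], hence by the value at any admissible
   [K'], even one that does not divide [T]. *)
- move=> K' K'_gt0 cK'_le; apply: le_trans reg_le _.
  exact: K_opt.
Qed.
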